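(* Let $R,\mathcal{A}_n,\phi,q,A,W,k,E_1,E_2,y,z,\mathcal{B}_1,\phi_1$ be as in the context. Then $\operatorname{Im}(\mathrm{I}-\phi)$ is the $R$-submodule of $\mathcal{A}_n$ consisting of all $f(x)\in\mathcal{A}_n$ of the form $$f(x)=a_0(y)+\sum_{0\ne\beta\in E_2}a_\beta(y)z^\beta$$ with $a_\beta(y)\in\mathcal{B}_1$ for $0\neq\beta\in E_2$ (only finitely many nonzero) and $a_0(y)\in\operatorname{Im}(\mathrm{I}_{\mathcal{B}_1}-\phi_1)$.
   Context: $R$ is an integral domain of characteristic zero with unit group $R^*$, and $\mathcal{A}_n=R[x_1^{\pm1},\dots,x_n^{\pm1}]$. Fix $q=(q_1,\dots,q_n)$ with $q_i\in R^*$ and $A\in M_n(\mathbb{Z})$ invertible of finite order $r$. $\phi$ is the $R$-algebra endomorphism of $\mathcal{A}_n$ with $\phi(x^\alpha)=q^\alpha x^{A\alpha}$ for all $\alpha\in\mathbb{Z}^n$ (where $q^\alpha=\prod_i q_i^{\alpha_i}$). Assume that $R$ contains $\mathbb{Q}(q)$, the field of fractions of $\mathbb{Z}[q]\subseteq R$. Put $\tilde A=\mathrm{I}_n+A+\cdots+A^{r-1}$ and $W=\{\alpha\in\mathbb{Z}^n : q^{\tilde A\alpha}=1\}$. Assume $W\ne0$ and that $W$ is freely generated by $d_1e_1,\dots,d_ke_k$ for some $1\le k\le n$ and positive integers $d_1\mid d_2\mid\cdots\mid d_k$, where $(e_1,\dots,e_n)$ is the standard basis of $\mathbb{Z}^n$.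 $E_1$ (resp. $E_2$) is the subgroup of $\mathbb{Z}^n$ generated by $e_i$ with $1\le i\le k$ (resp. $k+1\le i\le n$); $\ell=n-k$; $y=(y_1,\dots,y_k)=(x_1,\dots,x_k)$; $z=(z_1,\dots,z_\ell)=(x_{k+1},\dots,x_n)$; for $\beta\in E_2$, $z^\beta=\prod_{j=1}^{\ell}z_j^{\beta_{k+j}}$. $\mathcal{B}_1=R[y_1^{\pm1},\dots,y_k^{\pm1}]$, which satisfies $\phi(\mathcal{B}_1)\subseteq\mathcal{B}_1$, and $\phi_1=\phi|_{\mathcal{B}_1}$. $\mathrm{I}$ and $\mathrm{I}_{\mathcal{B}_1}$ denote identity maps. *)

(* Defs.v *)
From HB Require Import structures.
From mathcomp Require Import all_boot all_order all_algebra finmap.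
From mathcomp Require Import boolp classical_sets.
From mathcomp.multinomials Require mpoly.
From mathcomp.multinomials Require Import monalg.

Set Implicit Arguments.
Unset Strict Implicit.
Unset Printing Implicit Defensive.

Import GRing.Theory.
Local Open Scope ring_scope.

(* [monalg] puts a product on {malg R[K]} only when K has no nontrivial
   invertible element, which excludes K = Z^n: the product is supplied here. *)
Definition laurent (R : comNzRingType) (n : nat) : Type := {malg R['cV[int]_n]}.

Section LaurentAlgebra.
Context {R : comNzRingType} {n : nat}.
Local Notation L := (laurent R n).

HB.instance Definition _ := GRing.Lmodule.on L.

Definition lmon (a : 'cV[int]_n) : L := << a >>.

Definition lone : L := lmon 0.
Definition lmul (f g : L) : L :=
  \sum_(a <- msupp f) \sum_(b <- msupp g) << f@_a * g@_b *g a + b >>.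

Lemma lmulEw (E F : {fset 'cV[int]_n}) (f g : L) :
    (msupp f `<=` E)%fset -> (msupp g `<=` F)%fset ->
  lmul f g = \sum_(a <- E) \sum_(b <- F) << f@_a * g@_b *g a + b >>.
Proof.
move=> fE gF; rewrite /lmul (big_fset_incl _ fE) /=.
  apply/eq_bigr => a _; apply/big_fset_incl => // b _ /mcoeff_outdom ->.
  by rewrite mulr0 monalgU0.
move=> a _ /mcoeff_outdom fa.
by rewrite big1 // => b _; rewrite fa mul0r monalgU0.
Qed.

Lemma lmulUU (c d : R) (a b : 'cV[int]_n) :
  lmul << c *g a >> << d *g b >> = << c * d *g a + b >>.
Proof. by rewrite (lmulEw msuppU_le msuppU_le) !big_seq_fset1 !mcoeffUU. Qed.

Lemma lmulC : commutative lmul.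
Proof.
move=> f g; rewrite /lmul exchange_big; apply/eq_bigr => a _.
by apply/eq_bigr => b _; rewrite mulrC addrC.
Qed.

Lemma lmulDl : left_distributive lmul +%R.
Proof.
move=> f g h.
have fS := fsubsetUl (msupp f) (msupp g); have gS := fsubsetUr (msupp f) (msupp g).
rewrite (lmulEw fS (fsubset_refl _)) (lmulEw gS (fsubset_refl _)).
rewrite (lmulEw (msuppD_le f g) (fsubset_refl _)) -big_split /=.
apply/eq_bigr => a _; rewrite -big_split /=; apply/eq_bigr => b _.
by rewrite mcoeffD mulrDl monalgUD.
Qed.

Lemma lmul0l : left_zero 0 lmul.
Proof. by move=> f; rewrite /lmul msupp0 big_seq_fset0. Qed.

Lemma lmul_suml (I : Type) (s : seq I) (F : I -> L) g :
  lmul (\sum_(i <- s) F i) g = \sum_(i <- s) lmul (F i) g.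
Proof. exact: (big_morph (lmul^~ g) (fun _ _ => lmulDl _ _ _) (lmul0l _)). Qed.

Lemma lmul_sumr (I : Type) (s : seq I) (F : I -> L) g :
  lmul g (\sum_(i <- s) F i) = \sum_(i <- s) lmul g (F i).
Proof. by rewrite lmulC lmul_suml; apply: eq_bigr => i _; rewrite lmulC. Qed.

Lemma lmulEl (f g : L) : lmul f g = \sum_(a <- msupp f) lmul << f@_a *g a >> g.
Proof. by rewrite [X in lmul X g]monalgE lmul_suml. Qed.

Lemma lmulEr (f g : L) : lmul f g = \sum_(b <- msupp g) lmul f << g@_b *g b >>.
Proof. by rewrite [X in lmul _ X]monalgE lmul_sumr. Qed.

Lemma lmulA : associative lmul.
Proof.
have lmulUA c a g h : lmul << c *g a >> (lmul g h) = lmul (lmul << c *g a >> g) h.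
  rewrite (lmulEl g h) (lmulEr << c *g a >> g) [LHS]lmul_sumr [RHS]lmul_suml.
  apply: eq_bigr => b _; rewrite lmulUU (lmulEr _ h) (lmulEr << _ *g a + b >> h).
  rewrite [LHS]lmul_sumr.
  by apply: eq_bigr => d _; rewrite !lmulUU mulrA addrA.
move=> f g h; rewrite (lmulEl f) (lmulEl f g) [RHS]lmul_suml.
by apply: eq_bigr => a _; apply: lmulUA.
Qed.

Lemma lmul1l : left_id lone lmul.
Proof.
move=> f; rewrite [in LHS](monalgE f) [RHS]monalgE lmul_sumr.
by apply: eq_bigr => a _; rewrite lmulUU mul1r add0r.
Qed.

Lemma lone_neq0 : lone != 0.
Proof. by rewrite monalgU_eq0 oner_eq0. Qed.

HB.instance Definition _ := GRing.Zmodule_isComNzRing.Build L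
  lmulA lmulC lmul1l lmulDl lone_neq0.

Lemma lscaleU (c d : R) (a : 'cV[int]_n) :
  c *: (<< d *g a >> : L) = << c * d *g a >>.
Proof. by apply/malgP => b; rewrite mcoeffZ !mcoeffU mulrnAr. Qed.

Lemma lscaleE (c : R) (f : L) : c *: f = lmul << c *g 0 >> f.
Proof.
rewrite [in LHS](monalgE f) [in RHS](monalgE f) scaler_sumr.
rewrite lmul_sumr; apply: eq_bigr => a _.
by rewrite lscaleU lmulUU add0r.
Qed.

Lemma lscaleAl (c : R) (f g : L) : c *: (f * g) = (c *: f) * g.
Proof. by rewrite !lscaleE; exact: lmulA. Qed.

HB.instance Definition _ := GRing.Lmodule_isLalgebra.Build R L lscaleAl.
HB.instance Definition _ := GRing.Lalgebra_isComAlgebra.Build R L.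

Definition lunit : pred L := fun f => `[< exists g, g * f = 1 >].
Definition linv (f : L) : L := xget f [set g | g * f = 1].

Lemma lmulVl : {in lunit, left_inverse 1 linv *%R}.
Proof.
move=> f /asboolP[g gf1].
exact: (@xgetPex _ f [set h | h * f = 1] (ex_intro _ g gf1)).
Qed.

Lemma lunitP (f g : L) : g * f = 1 -> lunit f.
Proof. by move=> gf1; apply/asboolP; exists g. Qed.

Lemma linv_out : {in [predC lunit], linv =1 id}.
Proof.
move=> f /negP fN; apply: xgetPN => g gf1.
by apply: fN; apply/asboolP; exists g.
Qed.

HB.instance Definition _ :=
  GRing.ComNzRing_hasMulInverse.Build L lmulVl lunitP linv_out.

End LaurentAlgebra.

Definition evec {n : nat} (i : 'I_n) : 'cV[int]_n := delta_mx i 0.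

Definition lvar {R : comNzRingType} {n : nat} (i : 'I_n) : laurent R n :=
  lmon (evec i).

Lemma lmonD (R : comNzRingType) (n : nat) (a b : 'cV[int]_n) :
  lmon (a + b) = lmon a * lmon b :> laurent R n.
Proof. by rewrite [RHS]lmulUU mulr1. Qed.

Lemma lmonMz (R : comNzRingType) (n : nat) (a : 'cV[int]_n) (m : int) :
  lmon (a *~ m) = lmon a ^ m :> laurent R n.
Proof.
have lmonMn b k : lmon (b *+ k) = lmon b ^+ k :> laurent R n.
  by elim: k => [//|k IHk]; rewrite mulrS exprS lmonD IHk.
have lmonN b : lmon (- b) = (lmon b)^-1 :> laurent R n.
  have bV : lmon (- b) * lmon b = 1 :> laurent R n by rewrite -lmonD addNr.
  have bU : (lmon b : laurent R n) \is a GRing.unit := lunitP bV.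
  by apply: (mulIr bU); rewrite bV mulVr.
case: m => m; first exact: lmonMn.
by rewrite NegzE mulrNz lmonN -pmulrn lmonMn.
Qed.

Lemma lmonE (R : comNzRingType) (n : nat) (a : 'cV[int]_n) :
  lmon a = \prod_(i < n) lvar i ^ a i 0 :> laurent R n.
Proof.
have {1}-> : a = \sum_(i < n) evec i *~ a i 0.
  apply/colP => j; rewrite summxE (bigD1 j) //= big1 ?addr0.
    by rewrite -scaler_int !mxE !eqxx mulr1 intz.
  by move=> i /negPf ij; rewrite -scaler_int !mxE eq_sym ij mulr0.
rewrite (big_morph (@lmon R n) (@lmonD R n) erefl).
by apply: eq_bigr => i _; rewrite lmonMz.
Qed.

Definition laurent_eval {R : comNzRingType} {S : comUnitAlgType R} {k : nat}
    (v : 'I_k -> S) (a : laurent R k) : S :=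
  \sum_(b <- msupp a) a@_b *: \prod_(i < k) v i ^ b i 0.

(* The subring R[y_1^+-1, ..., y_k^+-1], where y_i = x_i. *)
Definition laurent_head (R : comNzRingType) (n k : nat) (hk : (k <= n)%N) :
    set (laurent R n) :=
  range (laurent_eval (fun i : 'I_k => lvar (widen_ord hk i))).
Arguments laurent_head R {n k} hk.

(* z^b, where z_1, ..., z_(n - k) are the last n - k variables. *)
Definition zmon {R : comNzRingType} {n : nat} (k : nat) (b : 'cV[int]_n) :
    laurent R n :=
  \prod_(j < n | (k <= j)%N) lvar j ^ b j 0.

Definition im_id_sub {V : zmodType} (phi : V -> V) (D : set V) : set V :=
  [set f - phi f | f in D].

Definition is_submodule {R : comNzRingType} {V : lmodType R} (M : set V) : Prop :=
  M 0 /\ forall (c : R) (u v : V), M u -> M v -> M (c *: u + v).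

Definition generated {n : nat} {I : finType} (P : pred I)
    (v : I -> 'cV[int]_n) : set 'cV[int]_n :=
  [set a | exists c : I -> int, a = \sum_(i | P i) v i *~ c i].

Definition freely_generated {n : nat} {I : finType} (v : I -> 'cV[int]_n)
    (G : set 'cV[int]_n) : Prop :=
  G = generated predT v /\
  forall c : I -> int, \sum_i v i *~ c i = 0 -> forall i, c i = 0.

Definition qpow {R : unitRingType} {n : nat} (q : 'I_n -> R)
    (a : 'cV[int]_n) : R :=
  \prod_(i < n) q i ^ a i 0.

Definition has_order {n : nat} (A : 'M[int]_n) (r : nat) : Prop :=
  [/\ (0 < r)%N, A ^+ r = 1 & forall m, (0 < m < r)%N -> A ^+ m <> 1].

Definition Atilde {n : nat} (A : 'M[int]_n) (r : nat) : 'M[int]_n :=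
  \sum_(i < r) A ^+ i.

Definition Wset {R : unitRingType} {n : nat} (q : 'I_n -> R) (A : 'M[int]_n)
    (r : nat) : set 'cV[int]_n :=
  [set a | qpow q (Atilde A r *m a) = 1].

Definition Zadjoin {R : comNzRingType} {n : nat} (q : 'I_n -> R) : set R :=
  range (fun p : mpoly.mpoly n int => mpoly.mmap (intr : int -> R) q p).

(* Q(q) is formed inside the fraction field of R. *)
Definition contains_Qadjoin {R : idomainType} {n : nat} (q : 'I_n -> R) : Prop :=
  forall a b : R, Zadjoin q a -> Zadjoin q b -> b != 0 ->
  exists c : R, tofrac c = tofrac a / tofrac b.

(* Main.v *)
(* [E1] is the set of exponents some positive multiple of which lies in [W].
   Since [Atilde *m A = Atilde], [A] preserves [W], hence both [E1] and its
   complement, and so [I - phi] respects the splitting of a Laurent polynomial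
   into its parts supported inside and outside [E1]. On the outer part it is
   onto: if [a] is not in [W], then [x^a - phi^r (x^a)] is [1 - q^(Atilde a)]
   times [x^a], this factor is a unit because [R] contains Q(q), and [I - phi]
   divides [I - phi^r]. *)
Require Import Defs.
From HB Require Import structures.
From mathcomp Require Import all_boot all_order all_algebra finmap.
From mathcomp Require Import boolp classical_sets.
From mathcomp.multinomials Require Import monalg.
From mathcomp.multinomials Require mpoly.

Set Implicit Arguments.
Unset Strict Implicit.
Unset Printing Implicit Defensive.

Import GRing.Theory.
Local Open Scope classical_set_scope.
Local Open Scope ring_scope.

(** * Powers of [q], and units of the form [1 - q^a] *)

Section QPowers.
Variables (R : idomainType) (n : nat) (q : 'I_n -> R).

Lemma ZadjoinX (e : 'I_n -> nat) : Zadjoin q (\prod_i q i ^+ e i).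
Proof.
exists (mpoly.mpolyX int (mpoly.Multinom [tuple e i | i < n])) => //.
rewrite mpoly.mmapX /mpoly.mmap1; apply: eq_bigr => i _.
by rewrite mpoly.mnmE.
Qed.

Lemma ZadjoinB (a b : R) : Zadjoin q a -> Zadjoin q b -> Zadjoin q (a - b).
Proof. by case=> u _ <- [v _ <-]; rewrite -mpoly.mmapB; eexists. Qed.

Hypothesis q_unit : forall i, q i \is a GRing.unit.

Lemma qpowD (a b : 'cV[int]_n) : qpow q (a + b) = qpow q a * qpow q b.
Proof.
rewrite /qpow -big_split; apply: eq_bigr => i _ /=.
by rewrite mxE exprzDr.
Qed.

Lemma qpow0 : qpow q 0 = 1.
Proof. by rewrite /qpow big1 // => i _; rewrite mxE. Qed.

(** Clears denominators: [Negz m] stands for [-(m + 1)], hence the exponent [m.+1]. Both products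
    then have natural exponents and lie in [Z[q]]. *)
Lemma qpow_frac (a : 'cV[int]_n) :
  qpow q a * \prod_i q i ^+ (if a i 0 is Negz m then m.+1 else 0)
  = \prod_i q i ^+ (if a i 0 is Posz m then m else 0).
Proof.
rewrite /qpow -big_split; apply: eq_bigr => i _ /=.
case: (a i 0) => m; first by rewrite mulr1.
by rewrite NegzE -exprnN mulVr ?unitrX.
Qed.

(* [q^a] is a quotient [u / v] of monomials with natural exponents, and
   [v / (v - u)] lies in Q(q). *)
Lemma qpow_sub1_unit (a : 'cV[int]_n) :
  contains_Qadjoin q -> qpow q a != 1 -> 1 - qpow q a \is a GRing.unit.
Proof.
move=> Qq a1; have := qpow_frac a.
set v := \prod_i _; set u := \prod_i _ => auv.
have v0 : v \is a GRing.unit by rewrite rpred_prod // => i _; rewrite unitrX.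
have vNu : v - u = (1 - qpow q a) * v by rewrite mulrBl mul1r auv.
have vn0 : v != 0 by apply: contraTneq v0 => ->; rewrite unitr0.
have vu0 : v - u != 0.
  by rewrite vNu mulf_neq0 // subr_eq0 eq_sym.
have [c /(congr1 ( *%R^~ (FracField.tofrac (v - u))))] :=
  Qq v (v - u) (ZadjoinX _) (ZadjoinB (ZadjoinX _) (ZadjoinX _)) vu0.
rewrite mulfVK ?tofrac_eq0 // -tofracM => /eqP; rewrite tofrac_eq => /eqP cv.
(* The unit [v] equals [c * ((1 - q^a) * v)], so each factor is a unit. *)
by move: v0; rewrite -cv vNu !unitrM => /and3P[].
Qed.

End QPowers.

(** * Submodules and the image of [I - phi] *)

Section IdSub.
Variables (R : comNzRingType) (V : lmodType R) (phi : {linear V -> V}).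

Lemma im_id_sub_submodule : is_submodule (im_id_sub phi setT).
Proof.
split=> [|c u v [f _ <-] [g _ <-]]; first by exists 0; rewrite // linear0 subrr.
by exists (c *: f + g); rewrite // linearP scalerBr opprD addrACA.
Qed.

Lemma submodule_sum (M : set V) (I : eqType) (s : seq I) (P : pred I) (F : I -> V) :
  is_submodule M -> (forall i, i \in s -> P i -> M (F i)) ->
  M (\sum_(i <- s | P i) F i).
Proof.
case=> M0 MD FM; rewrite big_seq_cond.
elim/big_rec: _ => [//|i x /andP[si Pi] Mx].
by rewrite -[F i]scale1r; apply: MD => //; apply: FM.
Qed.

Lemma submoduleZ (M : set V) c v : is_submodule M -> M v -> M (c *: v).
Proof. by case=> M0 MD Mv; rewrite -[_ *: _]addr0; apply: MD. Qed.

Lemma submoduleD (M : set V) u v : is_submodule M -> M u -> M v -> M (u + v).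
Proof. by case=> M0 MD Mu Mv; rewrite -[u]scale1r; apply: MD. Qed.

(** Telescoping: a preimage is [f + phi f + ... + phi^(i-1) f]. *)
Lemma im_id_sub_iter (f : V) i : im_id_sub phi setT (f - iter i phi f).
Proof.
exists (\sum_(j < i) iter j phi f) => //; elim: i => [|i IHi].
  by rewrite big_ord0 linear0 !subrr.
by rewrite big_ord_recr /= linearD opprD addrACA IHi addrA subrK.
Qed.

End IdSub.

(** * Stability of [W] under [A] *)

Lemma Atilde_mulr (n : nat) (A : 'M[int]_n) (r : nat) :
  A ^+ r = 1 -> Atilde A r * A = Atilde A r.
Proof.
case: r => [|r] Ar; rewrite /Atilde mulr_suml; first by rewrite !big_ord0.
under eq_bigr do rewrite -exprSr.
(* The exponents have shifted by one; the last power is the identity and takes the place of the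
   missing [A ^+ 0]. *)
by rewrite big_ord_recr /= Ar addrC [RHS]big_ord_recl.
Qed.

Lemma Wset_mul (R : unitRingType) (n : nat) (q : 'I_n -> R) (A : 'M[int]_n)
    (r : nat) (a : 'cV[int]_n) :
  A ^+ r = 1 -> Wset q A r a -> Wset q A r (A *m a).
Proof.
move=> /Atilde_mulr AtA.
by rewrite /Wset /= mulmxA (AtA : Atilde A r *m A = _).
Qed.

Lemma mulmx_Mn (n : nat) (A : 'M[int]_n) (a : 'cV[int]_n) m :
  A *m (a *+ m) = (A *m a) *+ m.
Proof. exact: (raddfMn (mulmx A)). Qed.

(** * Splitting exponents along [E1] and [E2] *)

Section Tail.
Variables (n k : nat).
Implicit Types a b : 'cV[int]_n.

(* The projection onto [E2] along [E1]: [tail k a = 0] encodes [a] in [E1], and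
   [tail k a = a] encodes [a] in [E2]. *)
Definition tail a : 'cV[int]_n := \col_i (if (k <= i)%N then a i 0 else 0).

Fact tail_is_zmod_morphism : zmod_morphism tail.
Proof. by move=> a b; apply/colP => i; rewrite !mxE; case: leqP; rewrite ?subr0. Qed.
HB.instance Definition _ :=
  GRing.isZmodMorphism.Build _ _ tail tail_is_zmod_morphism.

Lemma tail_idem a : tail (tail a) = tail a.
Proof. by apply/colP => i; rewrite !mxE; case: leqP. Qed.

Lemma cV_sum_evec a : a = \sum_i evec i *~ a i 0.
Proof.
apply/colP => j; rewrite summxE (bigD1 j) //= big1 ?addr0.
  by rewrite -scaler_int !mxE !eqxx mulr1 intz.
by move=> i /negPf ij; rewrite -scaler_int !mxE eq_sym ij mulr0.
Qed.

Lemma tail_evec (i : 'I_n) : tail (evec i) = if (k <= i)%N then evec i else 0.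
Proof.
apply/colP => j; rewrite !mxE.
case: (leqP k i) => ki; rewrite !mxE; case: leqP => // kj; case: eqVneq => // ji.
  by rewrite ji ltnNge ki in kj.
by rewrite ji leqNgt ki in kj.
Qed.

Lemma tail_sum_evec a :
  tail a = \sum_(i < n | (k <= i)%N) evec i *~ a i 0.
Proof.
rewrite {1}[a]cV_sum_evec raddf_sum [RHS]big_mkcond.
apply: eq_bigr => i _; rewrite raddfMz /= tail_evec.
by case: leqP; rewrite ?mul0rz.
Qed.

Lemma generated_tail a :
  generated (fun i : 'I_n => (k <= i)%N) evec a <-> tail a = a.
Proof.
split=> [[c ->]|<-]; last by exists (fun i => a i 0); apply: tail_sum_evec.
rewrite raddf_sum; apply: eq_bigr => i ki.
by rewrite raddfMz /= tail_evec ki.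
Qed.

Lemma zmonE (R : comNzRingType) a : zmon k a = lmon (tail a) :> laurent R n.
Proof.
rewrite tail_sum_evec (big_morph (@lmon R n) (@lmonD R n) erefl).
by apply: eq_bigr => i _; rewrite lmonMz.
Qed.

End Tail.

(** * Laurent polynomials in the first [k] variables *)

Section Head.
Variables (n k : nat) (hk : (k <= n)%N).

(** The inclusion of [Z^k] into [Z^n] with image [E1]. *)
Definition embed (b : 'cV[int]_k) : 'cV[int]_n :=
  \sum_(i < k) evec (widen_ord hk i) *~ b i 0.

Lemma tail_evec_widen (i : 'I_k) : tail k (evec (widen_ord hk i)) = 0.
Proof. by rewrite tail_evec leqNgt /= ltn_ord. Qed.

Lemma tail_embed b : tail k (embed b) = 0.
Proof.
by rewrite raddf_sum big1 // => i _; rewrite raddfMz /= tail_evec_widen mul0rz.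
Qed.

Lemma tail0_embed (a : 'cV[int]_n) :
  tail k a = 0 -> a = embed (\col_i a (widen_ord hk i) 0).
Proof.
move=> ta; rewrite {1}[a]cV_sum_evec (bigID (fun i : 'I_n => (k <= i)%N)) /=.
rewrite -tail_sum_evec ta add0r.
under eq_bigl do rewrite -ltnNge.
by rewrite big_ord_narrow; apply: eq_bigr => i _; rewrite mxE.
Qed.

Variable R : comNzRingType.
Local Notation L := (laurent R n).

Lemma laurent_eval_lvar (a : laurent R k) :
  laurent_eval (fun i => lvar (widen_ord hk i)) a =
  \sum_(b <- msupp a) a@_b *: (lmon (embed b) : L).
Proof.
apply: eq_bigr => b _; rewrite /embed (big_morph (@lmon R n) (@lmonD R n) erefl).
by congr (_ *: _); apply: eq_bigr => i _; rewrite lmonMz.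
Qed.

Lemma laurent_head_sum (I : eqType) (s : seq I) (P : pred I) (c : I -> R)
    (a : I -> 'cV[int]_n) :
  (forall i, P i -> tail k (a i) = 0) ->
  laurent_head R hk (\sum_(i <- s | P i) c i *: lmon (a i)).
Proof.
move=> ta.
exists (\sum_(i <- s | P i) << c i *g \col_j (a i) (widen_ord hk j) 0 >>) => //.
rewrite laurent_eval_lvar.
(* Passing to [mmap], which is additive, allows evaluation term by term, whatever cancellations
   occur in the support. *)
transitivity (mmap (@GRing.in_alg R L) (fun b => lmon (embed b))
  (\sum_(i <- s | P i) << c i *g \col_j (a i) (widen_ord hk j) 0 >>)).
  by apply: eq_bigr => b _; rewrite /= mulr_algl.
rewrite raddf_sum; apply: eq_bigr => i Pi.
by rewrite /= mmapU /= mulr_algl -tail0_embed // ta.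
Qed.

End Head.

Lemma scale_lmon (R : comNzRingType) (n : nat) (c : R) (a : 'cV[int]_n) :
  c *: lmon a = << c *g a >> :> laurent R n.
Proof. by rewrite /lmon lscaleU mulr1. Qed.

Lemma mcoeff_lmonB (R : comNzRingType) (n : nat) (c1 c2 : R)
    (a1 a2 b : 'cV[int]_n) :
  a1 != b -> a2 != b ->
  (c1 *: lmon a1 - c2 *: lmon a2 : laurent R n)@_b = 0.
Proof.
move=> /negPf a1b /negPf a2b.
by rewrite !scale_lmon mcoeffB !mcoeffU a1b a2b subrr.
Qed.

(** * Action of [phi] on monomials inside and outside [E1] *)

Section TwistedMonomialMap.
Variables (R : idomainType) (n : nat) (q : 'I_n -> R).
Hypothesis q_unit : forall i, q i \is a GRing.unit.
Variables (A : 'M[int]_n) (r : nat).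
Hypothesis A_order : has_order A r.
Variable phi : {linear laurent R n -> laurent R n}.
Hypothesis phiE :
  forall a : 'cV[int]_n, phi (lmon a) = qpow q a *: lmon (A *m a).
Hypothesis Qq_R : contains_Qadjoin q.
Variables (k : nat) (k_le_n : (k <= n)%N) (d : 'I_k -> nat).
Hypothesis d_gt0 : forall i, (0 < d i)%N.
Hypothesis W_free :
  freely_generated (fun i : 'I_k => evec (widen_ord k_le_n i) *+ d i)
    (Wset q A r).

(** The factors [q^a], [q^(A a)], ..., [q^(A^(i-1) a)] accumulate; this is where [Atilde] comes
    from. *)
Lemma iter_lmon i (a : 'cV[int]_n) :
  iter i phi (lmon a) = qpow q (Atilde A i *m a) *: lmon (A ^+ i *m a).
Proof.
elim: i => [|i IHi] /=.
  by rewrite /Atilde big_ord0 mul0mx qpow0 scale1r expr0 (mul1mx a).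
rewrite IHi linearZ_LR phiE scalerA -(qpowD q_unit) -mulmxDl mulmxA exprS.
rewrite /Atilde big_ord_recr; reflexivity.
Qed.

Lemma Wset_tail (a : 'cV[int]_n) : Wset q A r a -> tail k a = 0.
Proof.
rewrite W_free.1 => -[c ->]; rewrite raddf_sum big1 // => i _.
by rewrite raddfMz raddfMn /= tail_evec_widen mul0rn mul0rz.
Qed.

Lemma tail_Wset (a : 'cV[int]_n) :
  tail k a = 0 -> Wset q A r (a *+ \prod_i d i).
Proof.
rewrite W_free.1 => /(tail0_embed k_le_n) ->.
(* The generator [d i *: e_i] already supplies the factor [d i]; the coefficient carries the rest of
   the product. *)
set b := \col_i _; exists (fun i => b i 0 * (\prod_(j | j != i) d j)%N%:Z).
rewrite /embed -sumrMnl; apply: eq_bigr => i _.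
by rewrite (bigD1 i) //= !pmulrn -!mulrzA PoszM mulrCA.
Qed.

(** A positive multiple of [a] lies in [W], which [A] preserves; the multiple is then removed
    because the integers have no torsion. *)
Lemma tail_mulmx (a : 'cV[int]_n) : tail k a = 0 -> tail k (A *m a) = 0.
Proof.
have [_ Ar _] := A_order.
move=> /tail_Wset /(Wset_mul Ar) /Wset_tail.
rewrite mulmx_Mn raddfMn /= => /colP tAa; apply/colP => i.
have := tAa i; rewrite mulmxnE [in RHS]mxE => /eqP.
rewrite Num.Theory.mulrn_eq0 => /orP[|/eqP->]; last by rewrite mxE.
by rewrite -leqn0 leqNgt prodn_gt0.
Qed.

(** The inverse of [A] is the power [A ^+ r.-1], so it preserves [E1] as well. *)
Lemma tail_mulmxI (a : 'cV[int]_n) : tail k (A *m a) = 0 -> tail k a = 0.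
Proof.
have [r_gt0 Ar _] := A_order => tAa.
have Ar1 : A ^+ r.-1 *m A = 1%:M.
  by rewrite -[RHS]Ar -[in RHS](prednK r_gt0) exprSr.
have -> : a = A ^+ r.-1 *m (A *m a) by rewrite mulmxA Ar1 mul1mx.
elim: r.-1 => [|i IHi]; first by rewrite expr0 (mul1mx (A *m a)).
by rewrite exprS -(mulmxA A) tail_mulmx.
Qed.

Lemma lmon_im_id_sub (c : R) (a : 'cV[int]_n) :
  tail k a <> 0 -> im_id_sub phi setT (c *: lmon a).
Proof.
have [_ Ar _] := A_order => ta.
have qa1 : qpow q (Atilde A r *m a) != 1.
  by apply/eqP => /Wset_tail.
have [f _ fE] := im_id_sub_iter phi (lmon a) r.
have -> : c *: lmon a = (c / (1 - qpow q (Atilde A r *m a))) *: (f - phi f).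
  rewrite fE iter_lmon Ar (mul1mx a) -[in X in _ *: (X - _)](scale1r (lmon a)).
  by rewrite -scalerBl scalerA divrK // qpow_sub1_unit.
by apply: (submoduleZ _ (im_id_sub_submodule phi)); exists f.
Qed.

(* The exponents are split by their tail: [0] gives the [B1] part, and a
   nonzero tail [b] gives the coefficient of [z^b]. *)
Lemma tail_decomposition (g : laurent R n) :
  (forall a, a \in msupp g -> tail k a <> 0) ->
  exists (S : {fset 'cV[int]_n}) (c : 'cV[int]_n -> laurent R n),
    (forall b, b \in S ->
      [/\ generated (fun i : 'I_n => (k <= i)%N) evec b, b != 0
        & laurent_head R k_le_n (c b)]) /\
    g = \sum_(b <- S) c b * zmon k b.
Proof.
move=> tg; exists [fset tail k a | a in msupp g]%fset.
exists (fun b => \sum_(a <- msupp g | tail k a == b) g@_a *: lmon (a - tail k a)).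
split=> [b /imfsetP[/= a /tg ta ->]|].
  split; first exact/generated_tail/tail_idem.
    exact/eqP.
  by apply: laurent_head_sum => c _; rewrite raddfB /= tail_idem subrr.
rewrite [LHS]monalgE (partition_big_imfset _ (tail k)).
apply: eq_bigr => b _; rewrite mulr_suml; apply: eq_bigr => a /eqP <-.
rewrite zmonE tail_idem -scalerAl -lmonD subrK.
by rewrite scale_lmon.
Qed.

End TwistedMonomialMap.

Theorem theorem3p10 (R : idomainType) (charR : [pchar R] =i pred0)
    (n : nat) (q : 'I_n -> R) (q_unit : forall i, q i \is a GRing.unit)
    (A : 'M[int]_n) (A_unit : A \in unitmx)
    (r : nat) (A_order : has_order A r)
    (phi : {lrmorphism laurent R n -> laurent R n})
    (phiE : forall a : 'cV[int]_n, phi (lmon a) = qpow q a *: lmon (A *m a))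
    (Qq_R : contains_Qadjoin q)
    (W_neq0 : exists2 a, Wset q A r a & a != 0)
    (k : nat) (k_gt0 : (0 < k)%N) (k_le_n : (k <= n)%N)
    (d : 'I_k -> nat) (d_gt0 : forall i, (0 < d i)%N)
    (d_dvd : forall i j : 'I_k, (i <= j)%N -> (d i %| d j)%N)
    (W_free :
      freely_generated (fun i : 'I_k => evec (widen_ord k_le_n i) *+ d i)
        (Wset q A r)) :
  let B1 : set (laurent R n) := laurent_head R k_le_n in
  let E2 : set 'cV[int]_n := generated (fun i : 'I_n => (k <= i)%N) evec in
  is_submodule (im_id_sub phi setT) /\
  im_id_sub phi setT =
    [set f | exists (a0 : laurent R n) (S : {fset 'cV[int]_n})
                    (a : 'cV[int]_n -> laurent R n),
       [/\ im_id_sub phi B1 a0,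
           forall b, b \in S -> [/\ E2 b, b != 0 & B1 (a b)]
         & f = a0 + \sum_(b <- S) a b * zmon k b]].
Proof.
move=> B1 E2; have M := im_id_sub_submodule phi.
split=> //; apply/seteqP; split=> [_ [f _ <-]|_ [_ [S [a [[f _ <-] Sa ->]]]]].
  pose f1 : laurent R n := \sum_(c <- msupp f | tail k c == 0) f@_c *: lmon c.
  pose f2 : laurent R n := \sum_(c <- msupp f | tail k c != 0) f@_c *: lmon c.
  have -> : f = f1 + f2.
    rewrite [LHS]monalgE (bigID (fun c => tail k c == 0)).
    by congr (_ + _); apply: eq_bigr => c _; rewrite scale_lmon.
  (* Neither [f2] nor [phi f2] has an exponent in [E1], since [A] preserves the complement of
     [E1]. *)
  have mcoeff_f2 b : tail k b = 0 -> (f2 - phi f2)@_b = 0.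
    move=> tb; rewrite /f2 linear_sum -sumrB raddf_sum big1 // => c tc.
    rewrite linearZ_LR /= phiE scalerA.
    apply: mcoeff_lmonB; apply: contraNneq tc => cb; apply/eqP.
      by rewrite cb.
    by apply: (tail_mulmxI A_order d_gt0 W_free); rewrite cb.
  have [|S [a [Sa f2E]]] := @tail_decomposition _ _ k k_le_n (f2 - phi f2).
    by move=> b /[swap] /mcoeff_f2 /eqP; rewrite mcoeff_eq0 => /negP.
  (* The part [f1] has its exponents in [E1], so it lies in [B1] and yields [a0]. *)
  exists (f1 - phi f1), S, a; split=> //.
    by exists f1 => //; apply: laurent_head_sum => c /eqP.
  by rewrite -f2E linearD opprD addrACA.
apply: (submoduleD M); first by exists f.
rewrite big_seq; apply: (submodule_sum M) => b _ /Sa[].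
move=> /generated_tail tb /eqP b0 [p _ <-].
(* Each monomial of [a b * z^b] has an exponent [embed c + b], whose tail is [b], hence nonzero. *)
rewrite laurent_eval_lvar mulr_suml; apply: (submodule_sum M) => c _ _.
rewrite zmonE tb -scalerAl -lmonD.
apply: (lmon_im_id_sub q_unit A_order phiE Qq_R W_free).
by rewrite raddfD /= tail_embed add0r tb.
Qed.
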